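(* Let $X$ be a compact (Hausdorff) space. Then the following are equivalent: (a) $C_p(X)$ is an Ascoli space; (b) $C_p(X)$ is Fréchet–Urysohn; (c) $X$ is scattered.
   Context: For a Tychonoff space $Y$, $C_p(Y)$ and $C_k(Y)$ denote the set $C(Y)$ of all continuous real-valued functions on $Y$ with the topology of pointwise convergence and the compact-open topology, respectively. A Tychonoff space $Y$ is called Ascoli if every compact subset $\mathcal K$ of $C_k(Y)$ is evenly continuous, i.e. the evaluation map $Y\times\mathcal K\to\mathbb R$, $(y,f)\mapsto f(y)$, is continuous. A space $Y$ is Fréchet–Urysohn if for every $A\subseteq Y$ and $y\in\overline A$ there is a sequence in $A$ converging to $y$. A space is scattered if each of its nonempty subspaces has an isolated point. *)

(* Defs.v *)
From HB Require Import structures.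
From mathcomp Require Import all_boot all_order all_algebra.
From mathcomp Require Import all_classical all_reals all_analysis.

Set Implicit Arguments.
Unset Strict Implicit.
Unset Printing Implicit Defensive.

Import numFieldNormedType.Exports.
Local Open Scope classical_set_scope.
Local Open Scope ring_scope.

(* C_p(Y) and C_k(Y) share the carrier C(Y) = [continuousType Y R]; they are
   distinct names so that each can carry its own topology, inherited from all
   functions Y -> R with the pointwise, resp. compact-open, topology. *)
Definition Cp (R : realType) (Y : topologicalType) : Type :=
  continuousType Y R.

HB.instance Definition _ (R : realType) (Y : topologicalType) :=
  Topological.copy (Cp R Y)
    (@initial_topology (continuousType Y R) {ptws Y -> R} id).

Definition Ck (R : realType) (Y : topologicalType) : Type :=
  continuousType Y R.

HB.instance Definition _ (R : realType) (Y : topologicalType) :=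
  Topological.copy (Ck R Y)
    (@initial_topology (continuousType Y R) {compact-open, Y -> R} id).

Definition tychonoff_space (Y : topologicalType) : Prop :=
  hausdorff_space Y /\ completely_regular_space Y.

(* [K] as a factor of the product is the subtype with the topology induced
   by C_k(Y). *)
Definition evenly_continuous (R : realType) (Y : topologicalType)
    (K : set (Ck R Y)) : Prop :=
  continuous
    (fun p : Y * set_type K => (set_val p.2 : continuousType Y R) p.1).

Definition ascoli_space (R : realType) (Y : topologicalType) : Prop :=
  tychonoff_space Y /\
  forall K : set (Ck R Y), compact K -> evenly_continuous K.

Definition frechet_urysohn_space (Y : topologicalType) : Prop :=
  forall (A : set Y) (y : Y), closure A y ->
    exists2 u : nat -> Y, (forall n, A (u n)) & u @ \oo --> y.

Definition scattered_space (Y : topologicalType) : Prop :=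
  forall A : set Y, A !=set0 -> isolated A !=set0.

(* Main.v *)
(* (b) -> (a): if a compact K in C_k(Y) were not equicontinuous at y, there
   would be u_n --> y and f_n in K with |f_n(u_n) - f_n(y)| >= e for all n; this
   is impossible for a cluster point of (f_n) in C_k(Y), because a tail of (u_n)
   together with y is compact.

   (c) -> (b): as every X^n is compact, f in the closure of A is already in the
   closure of a countable subset B of A. The joint image of X under B and f is
   countable: otherwise the closed set of points without a neighbourhood of
   countable image has an isolated point x, and a closed neighbourhood of x is,
   up to the fibre of x, a countable union of compact sets of countable image.
   So only countably many evaluations matter, and a diagonal choice in B
   converges to f.

   (a) -> (c): if X is not scattered, a Cantor scheme (C_s) of closed sets and
   Zorn's lemma give a minimal closed F meeting every C_s: every open set that
   meets F then contains the trace on F of some C_s. Pick pairwise disjoint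
   finite subsets S_n of F with S_n meeting the first n of the C_s, and let
     f_n(g) = \prod_(x in S_n) max 0 (g x - n).
   By Baire's theorem in F, a pointwise bounded set of functions is uniformly
   bounded on the trace of some C_s, so f_n vanishes on it for n large; hence
   f_n --> 0 in C_k(C_p(X)). But every neighbourhood of 0 in C_p(X) contains,
   for n large, some g with g = n + 1 on S_n, so that f_n(g) = 1: the compact
   set consisting of 0 and the f_n is not evenly continuous. *)

Require Import Defs.
From HB Require Import structures.
From mathcomp Require Import all_boot all_order all_algebra.
From mathcomp Require Import all_classical all_reals all_analysis.

Set Implicit Arguments.
Unset Strict Implicit.
Unset Printing Implicit Defensive.

Import Order.TTheory GRing.Theory Num.Theory.
Import numFieldNormedType.Exports.
Local Open Scope classical_set_scope.
Local Open Scope ring_scope.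

(** * Convergence in the pointwise and compact-open topologies *)

Lemma initial_cvgP (S : choiceType) (T : topologicalType) (f : S -> T)
    (F : set_system S) (s : S) : Filter F ->
  F --> (s : initial_topology f) <-> f @ F --> f s.
Proof.
move=> FF; split=> [Fs|fFs].
  by apply: cvg_comp Fs _; exact: initial_continuous.
move=> U [_ [[W oW <-] Wfs WU]].
by apply: filterS WU _; apply: fFs; exact: open_nbhs_nbhs.
Qed.

(* Type class resolution does not see through [Cp] to [nbhs_filter]. *)
#[local] Instance Cp_nbhs_filter (R : realType) (Y : topologicalType)
  (f : Cp R Y) : Filter (nbhs f) := nbhs_filter f.

Lemma Cp_cvgP (R : realType) (Y : topologicalType) (F : set_system (Cp R Y))
    (f : Cp R Y) : Filter F ->
  F --> f <-> forall y, (fun g : Cp R Y => g y) @ F --> f y.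
Proof. by move=> FF; rewrite initial_cvgP; exact: pointwise_cvgP. Qed.

Lemma Ck_cvgP (R : realType) (Y : topologicalType) (F : set_system (Ck R Y))
    (f : Ck R Y) : Filter F ->
  F --> f <-> forall (K : set Y) (O : set R), compact K -> open O ->
    f @` K `<=` O -> F [set g : Ck R Y | g @` K `<=` O].
Proof. by move=> FF; rewrite initial_cvgP compact_open_cvgP. Qed.

Lemma Cp_eval_continuous (R : realType) (Y : topologicalType) (y : Y) :
  continuous (fun g : Cp R Y => g y : R).
Proof. by move=> f; exact: (iffLR (Cp_cvgP f (nbhs_filter f)) cvg_id y). Qed.

Lemma Ck_eval_continuous (R : realType) (Y : topologicalType) (y : Y) :
  continuous (fun g : Ck R Y => g y : R).
Proof.
move=> f U fyU; have oU := @open_interior _ U.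
have := iffLR (Ck_cvgP f (nbhs_filter f)) cvg_id.
move=> /(_ [set y] U° (@compact_set1 _ y) oU); rewrite image_set1 sub1set inE.
move=> /(_ fyU) nU; apply: filterS nU => g; rewrite /= image_set1 => gU.
exact: interior_subset (gU _ erefl).
Qed.

Lemma Cp_hausdorff (R : realType) (Y : topologicalType) :
  hausdorff_space (Cp R Y).
Proof.
move=> f g fg; apply/continuousEP => y; apply: (@Rhausdorff R).
move=> A B fA gB; have := @Cp_eval_continuous R Y y.
move=> cE; have [h [Ah Bh]] := fg _ _ (cE f _ fA) (cE g _ gB).
by exists (h y).
Qed.

Lemma Cp_tychonoff (R : realType) (Y : topologicalType) :
  tychonoff_space (Cp R Y).
Proof.
split; first exact: Cp_hausdorff.
(* The topology of [Cp] comes from the uniformity of pointwise convergence. *)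
exact: (@uniform_completely_regular R
  (@initial_topology (continuousType Y R) {ptws Y -> R} id)).
Qed.

(** * From Fréchet-Urysohn to Ascoli *)

(** A filter on this set that does not cluster at [y] contains a finite set of terms, hence clusters
    at one of them. *)
Lemma compact_cvg_seq (Y : topologicalType) (u : nat -> Y) (y : Y) :
  u @ \oo --> y -> compact (y |` range u).
Proof.
move=> uy F PF Fu; have [yF|] := pselect (cluster F y).
  by exists y; split=> //; left.
move=> /existsNP[A /existsNP[U /not_implyP[FA /not_implyP[yU AU0]]]].
have [N _ NU] := uy _ yU.
have /finite_compact cN : finite_set (u @` `I_N) by exact: finite_image.
have FN : F (u @` `I_N).
  apply: filterS (filterI FA Fu) => z [Az [zy|[n _ unz]]].
    exfalso; apply: AU0; exists z; split=> //.
    by rewrite zy; exact: nbhs_singleton.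
  exists n => //=; rewrite ltnNge; apply/negP => Nn.
  apply: AU0; exists z; split=> //.
  by rewrite -unz; exact: NU.
have [z [[n _ unz] zF]] := cN F PF FN.
by exists z; split=> //; right; exists n.
Qed.

Lemma frechet_urysohn_equicontinuous (R : realType) (Y : topologicalType)
    (K : set (Ck R Y)) (y : Y) (e : R) : frechet_urysohn_space Y -> compact K ->
  0 < e -> \forall z \near y, forall f, K f -> `|f z - f y| < e.
Proof.
move=> FU cK e0.
pose A := [set z | exists2 f, K f & e <= `|f z - f y|].
suff : ~ closure A y.
  move=> /existsNP[U /not_implyP[yU AU0]]; apply: filterS yU => z Uz f Kf.
  rewrite ltNge; apply/negP => ef.
  by apply: AU0; exists z; split=> //; exists f.
move=> /FU[u Au uy].
have /choice[f fP] n : exists f, K f /\ e <= `|f (u n) - f y|.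
  by have [f ? ?] := Au n; exists f.
have Kf : (f @ \oo) K by exists 0%N => // n _; exact: (fP n).1.
have [g [Kg fg]] := cK _ _ Kf.
have : nbhs (g y) (ball (g y) (e / 2)) by apply: nbhsx_ballx; rewrite divr_gt0.
move=> /(@cts_fun _ _ g y) /uy [N _ NB].
(* Starting the tail at [N] makes [g] map all of [S] into the ball. An [f n] near [g] then has
   [f n (u n)] and [f n y] both within [e / 2] of [g y]. *)
pose S := y |` range (fun n => u (n + N)%N).
have cS : compact S.
  apply: compact_cvg_seq; apply: cvg_comp uy; exact: cvg_addnr.
have gS : nbhs g [set h : Ck R Y | h @` S `<=` ball (g y) (e / 2)].
  apply: (iffLR (Ck_cvgP g (nbhs_filter g)) cvg_id) => //.
    exact: ball_open.
  move=> _ [z [->|[n _ <-]] <-]; first by apply: ballxx; rewrite divr_gt0.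
  by apply: NB => /=; exact: leq_addl.
have fN : (f @ \oo) (f @` [set n | (N <= n)%N]).
  by exists N => // n Nn; exists n.
have [h [[n /= Nn <-] fS]] := fg _ _ fN gS.
have fy : ball (g y) (e / 2) (f n y) by apply: fS; exists y => //; left.
have funB : ball (g y) (e / 2) (f n (u n)).
  apply: fS; exists (u n) => //; right.
  by exists (n - N)%N => //; rewrite subnK.
have := (fP n).2; rewrite leNgt => /negP; apply.
rewrite [e]splitr.
apply: (@le_lt_trans _ _ (`|g y - f n (u n)| + `|g y - f n y|)).
  by rewrite (distrC (g y) (f n (u n))); exact: ler_distD.
by apply: ltrD.
Qed.

(** Equicontinuity controls the change of point uniformly over [K]; continuity of evaluation at [y]
    controls the change of function. *)
Lemma frechet_urysohn_ascoli (R : realType) (Y : topologicalType) :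
  tychonoff_space Y -> frechet_urysohn_space Y -> ascoli_space R Y.
Proof.
move=> tY FU; split=> // K cK [y k].
apply/cvgrPdist_lt => e e0; have e20 : 0 < e / 2 by rewrite divr_gt0.
have Uy := @frechet_urysohn_equicontinuous R Y K y (e / 2) FU cK e20.
pose ev (h : K) : R := (set_val h : Ck R Y) y.
have Wk : \forall k' \near k, `|ev k - ev k'| < e / 2.
  have evk : ev @ k --> ev k.
    apply: (@cvg_comp _ _ _ set_val (fun g : Ck R Y => g y)).
      exact: initial_continuous.
    exact: Ck_eval_continuous.
  by move/cvgrPdist_lt: evk; exact.
exists ([set z | forall f, K f -> `|f z - f y| < e / 2],
  [set k' : K | `|ev k - ev k'| < e / 2]) => //.
move=> [z k'] [/= zU kW].
have Kk' : K (set_val k') by exact: set_valP.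
rewrite [e]splitr; set a := (X in `|X - _|); set b := (X in `|_ - X|).
apply: (@le_lt_trans _ _ (`|a - ev k'| + `|ev k' - b|)); first exact: ler_distD.
by apply: ltrD => //; rewrite distrC; exact: zU.
Qed.

(** * From scattered to Fréchet-Urysohn *)

(** Induction on compact sets: if [P K] failed, the sets whose complement in [K] satisfies [P] would
    form a proper filter without cluster point in [K]. *)
Lemma compact_ideal (T : topologicalType) (K : set T) (P : set (set T)) :
  compact K -> P set0 -> (forall A B, A `<=` B -> P B -> P A) ->
  (forall A B, P A -> P B -> P (A `|` B)) ->
  (forall x, K x -> exists2 U, nbhs x U & P U) -> P K.
Proof.
move=> cK P0 Psub PU Ploc; apply: contrapT => nPK.
pose F : set_system T := [set A | P (K `\` A)].
have FF : ProperFilter F.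
  split; first by rewrite /F /= setD0.
  split; first by rewrite /F /= setDT.
    by move=> A B FA FB; rewrite /F /= setDIr; exact: PU.
  by move=> A B AB; apply: Psub; exact: setDS.
have [|x [Kx xF]] := cK F FF; first by rewrite /F /= setDv.
have [U xU PU'] := Ploc x Kx.
have [|y [/= ]//] := xF (~` U) U _ xU.
by apply: Psub PU' => y [_ /contrapT].
Qed.

Lemma near_distr_lt (R : realType) (T : topologicalType) (t : T)
    (p q : T -> R) (e : R) : {for t, continuous p} -> {for t, continuous q} ->
  `|p t - q t| < e -> \forall s \near t, `|p s - q s| < e.
Proof.
move=> cp cq; have /cvgr_lt : `|p s - q s| @[s --> t] --> `|p t - q t|.
  by apply: cvg_norm; exact: cvgB.
exact.
Qed.

(* Compactness of [X^n] makes finitely many members of [A] enough to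
   approximate [f] within [1/n] on all [n]-tuples simultaneously. *)
Lemma Cp_countable_tightness (R : realType) (X : topologicalType)
    (A : set (Cp R X)) (f : Cp R X) : compact [set: X] -> closure A f ->
  exists g : nat -> nat -> Cp R X, (forall n i, A (g n i)) /\
    forall n (t : 'I_n -> X), exists i, forall j,
      `|f (t j) - g n i (t j)| < n.+1%:R^-1.
Proof.
move=> cX Af.
pose near_tuple n (h : Cp R X) (t : 'I_n -> X) :=
  forall j, `|f (t j) - h (t j)| < n.+1%:R^-1.
have fin n : exists l : seq (Cp R X), (forall h, h \in l -> A h) /\
    forall t : 'I_n -> X, exists2 h, h \in l & near_tuple n h t.
  have cXn : compact [set: {ptws 'I_n -> X}].
    have := @tychonoff 'I_n (fun=> X) (fun=> setT) (fun=> cX).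
    by congr compact; apply/seteqP; split.
  pose P (B : set {ptws 'I_n -> X}) :=
    exists l : seq (Cp R X), (forall h, h \in l -> A h) /\
      forall t, B t -> exists2 h, h \in l & near_tuple n h t.
  suff [l [lA lP]] : P setT.
    by exists l; split=> // t; exact: lP.
  apply: compact_ideal cXn _ _ _ _.
  - by exists [::]; split.
  - by move=> B C BC [l [lA lC]]; exists l; split=> // t /BC; exact: lC.
  - move=> B C [l [lA lB]] [m [mA mC]]; exists (l ++ m); split=> [h|t].
      by rewrite mem_cat => /orP[/lA|/mA].
    by case=> [/lB|/mC] [h hl ht]; exists h; rewrite // mem_cat hl ?orbT.
  - move=> t _.
    have /Af [h [Ah ht]] : nbhs f [set h | near_tuple n h t].
      apply: (@filter_forall _ _
        (fun j (h : Cp R X) => `|f (t j) - h (t j)| < n.+1%:R^-1) _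
        (nbhs_filter f)) => j.
      have /cvgrPdist_lt := @Cp_eval_continuous R X (t j) f.
      by apply; rewrite invr_gt0.
    exists [set s | near_tuple n h s]; last first.
      exists [:: h]; split=> [h'|s hs]; first by rewrite inE => /eqP ->.
      by exists h; rewrite // inE.
    apply: (@filter_forall _ _
      (fun j (s : {ptws 'I_n -> X}) => `|f (s j) - h (s j)| < n.+1%:R^-1) _
      (nbhs_filter (t : {ptws 'I_n -> X}))) => j.
    have c (k : Cp R X) : k (s j) @[s --> (t : {ptws 'I_n -> X})] --> k (t j).
      apply: continuous_comp; last exact: cts_fun.
      exact: (@proj_continuous 'I_n (fun=> X) j).
    exact: near_distr_lt (c f) (c h) (ht j).
have [l lP] := choice fin.
have [g0 [Ag0 _]] := Af setT filterT.
exists (fun n i => nth g0 (l n) i); split=> [n i|n t].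
  have [il|li] := ltnP i (size (l n)); last by rewrite nth_default.
  by apply: (lP n).1; exact: mem_nth.
have [h hl ht] := (lP n).2 t.
by exists (index h (l n)); rewrite nth_index.
Qed.

Lemma countableU (T : Type) (A B : set T) :
  countable A -> countable B -> countable (A `|` B).
Proof.
by move=> cA cB; rewrite -bigcup2E; apply: bigcup_countable => // -[|[|n]].
Qed.

Lemma scattered_countable_image (R : realType) (X : topologicalType)
    (I : countType) (g : I -> X -> R) :
  compact [set: X] -> hausdorff_space X -> scattered_space X ->
  (forall i, continuous (g i)) -> countable (range (fun x i => g i x)).
Proof.
move=> cX hX sX cg; set phi := fun x i => g i x.
pose small (B : set X) := countable (phi @` B).
pose L := [set x : X | exists2 U, nbhs x U & small U].
have sub_small B C : B `<=` C -> small C -> small B.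
  by move=> BC; apply: sub_countable; exact/subset_card_le/image_subset.
have cptL K : compact K -> K `<=` L -> small K.
  move=> cK KL; apply: compact_ideal cK _ sub_small _ KL.
    by rewrite /small image_set0.
  by move=> B C sB sC; rewrite /small image_setU; exact: countableU.
suff LT : L = setT by apply: cptL => //; rewrite LT.
apply/seteqP; split=> // x0 _; apply: contrapT => nLx0.
have [x [/set_mem nLx [V xV VL]]] : isolated (~` L) !=set0.
  by apply: sX; exists x0.
have [C xC CV] := @compact_regular X x setT hX cX filterT V xV.
apply: nLx; exists (closure C).
  by apply: filterS xC; exact: subset_closure.
(* Off the fibre of [x] some coordinate differs from its value at [x] by at least some [1/(n+1)], so
   the [D k] and the fibre cover [closure C]. *)
pose D (k : I * nat) :=
  closure C `&` [set z | k.2.+1%:R^-1 <= `|g k.1 z - g k.1 x|].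
have CD : closure C `<=` [set z | phi z = phi x] `|` \bigcup_k D k.
  move=> z Cz; have [eqz|nphi] := pselect (phi z = phi x); [by left|right].
  have /existsNP[i giz] : ~ forall i, g i z = g i x.
    by move=> h; exact/nphi/funext.
  have : 0 < `|g i z - g i x| by rewrite normr_gt0 subr_eq0; apply/eqP.
  move=> /ltr_add_invr[n]; rewrite add0r => /ltW nz.
  by exists (i, n).
apply: sub_small CD _; rewrite /small image_setU; apply: countableU.
  apply: (@sub_countable _ _ _ [set phi x]) => //.
  by apply: subset_card_le => _ [z /= -> <-].
rewrite image_bigcup; apply: bigcup_countable => // k _.
apply: cptL.
  apply: compact_closedI.
    by apply: (subclosed_compact _ cX) => //; exact: closed_closure.
  apply: (@preimage_closed _ _ (fun z => `|g k.1 z - g k.1 x|)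
    [set r | k.2.+1%:R^-1 <= r]); last exact: closed_ge.
  move=> z _; apply: cvg_norm.
  by apply: cvgB; [exact: cg|exact: cvg_cst].
(* [V] meets the complement of [L] only at [x], and [x] is not in [D k]. *)
move=> z [/CV Vz /= gz]; apply: contrapT => nLz.
have : (V `&` ~` L) z by [].
rewrite VL => /= zx; move: gz; rewrite zx subrr normr0.
by rewrite leNgt invr_gt0 ltr0Sn.
Qed.

Lemma scattered_Cp_frechet_urysohn (R : realType) (X : topologicalType) :
  compact [set: X] -> hausdorff_space X -> scattered_space X ->
  frechet_urysohn_space (Cp R X).
Proof.
move=> cX hX sX A f Af.
have [g [Ag gf]] := Cp_countable_tightness cX Af.
have [[x0 _]|X0] := pselect ([set: X] !=set0); last first.
  exists (g 0%N) => //; apply/Cp_cvgP => x.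
  by exfalso; apply: X0; exists x.
(* Index [None] adds [f] itself, so that points with equal joint image also agree under [f]. *)
pose G (k : option (nat * nat)) : X -> R :=
  if k is Some k then g k.1 k.2 else f.
have cG k : continuous (G k) by case: k => [k|]; exact: cts_fun.
have /countable_injP[h hinj] := scattered_countable_image cX hX sX cG.
set phi := (fun (x : X) k => G k x) in hinj.
have /choice[t tP] (m : nat) :
    exists x, forall y, h (phi y) = m -> phi x = phi y.
  have [[y hy]|nm] := pselect (exists y, h (phi y) = m); last first.
    by exists x0 => y hy; exfalso; apply: nm; exists y.
  by exists y => z hz; apply: hinj; rewrite ?inE ?hy//; exists z.
(* The [n]-th choice approximates [f] on the first [n] representatives, hence on the fibres of all
   codes below [n]. *)
have /choice[i iP] n := gf n (fun j => t (nat_of_ord j)).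
exists (fun n => g n (i n)) => //.
apply/Cp_cvgP => y; apply/cvgrPdist_lt => e e0.
have tE : phi (t (h (phi y))) = phi y by exact: tP.
have inve := near_infty_natSinv_lt (PosNum e0).
suff : \forall n \near \oo, `|f y - g n (i n) y| < e by [].
near=> n.
have hn : (h (phi y) < n)%N by near: n; exact: nbhs_infty_gt.
have := iP n (Ordinal hn); rewrite /=.
have -> : f (t (h (phi y))) = f y by exact: (congr1 (@^~ None) tE).
have -> : g n (i n) (t (h (phi y))) = g n (i n) y.
  exact: (congr1 (@^~ (Some (n, i n))) tE).
move=> /lt_trans; apply; near: n; exact: inve.
Unshelve. all: by end_near. Qed.

(** * Cantor schemes and Baire category in non-scattered compact spaces *)

(** A neighbourhood of a point of [A] contains a second point of [A] in its interior; regularity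
    separates the two by neighbourhoods with disjoint closures, and this is iterated. *)
Lemma crowded_cantor_scheme (X : topologicalType) (A : set X) :
  compact [set: X] -> hausdorff_space X -> A !=set0 -> isolated A = set0 ->
  exists C : seq bool -> set X, [/\ forall s, closed (C s),
    forall s, C s !=set0, forall b s, C (b :: s) `<=` C s &
    forall s, C (true :: s) `&` C (false :: s) = set0].
Proof.
move=> cX hX [a0 Aa0] A0.
pose fat (V : set X) := exists2 a, A a & nbhs a V.
have reg (a : X) U : nbhs a U -> exists2 V, nbhs a V & closure V `<=` U.
  exact: (@compact_regular X a setT hX cX filterT).
have /choice[p pP] (V : set X) : exists p : set X * set X, fat V ->
    [/\ fat p.1, fat p.2, closure p.1 `<=` V, closure p.2 `<=` V &
        closure p.1 `&` closure p.2 = set0].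
  have [[a Aa aV]|nV] := pselect (fat V); last by exists (set0, set0).
  have [b [Ab Vb ba]] : exists b, [/\ A b, V° b & b <> a].
    apply: contrapT => nb; suff : isolated A a by rewrite A0.
    split; first exact/mem_set.
    exists V°; first exact: nbhs_interior.
    apply/seteqP; split=> [b [Vb Ab]|_ ->]; last by split.
    by apply: contrapT => ba; apply: nb; exists b.
  move: hX; rewrite open_hausdorff => /(_ a b).
  case; first by apply/eqP => ab; exact: ba.
  move=> [U W] [/set_mem Ua /set_mem Wb] [oU oW /eqP UW0].
  have [|U' aU' U'U] := reg a (U `&` V).
    by apply: filterI => //; exact: open_nbhs_nbhs.
  have [|W' bW' W'W] := reg b (W `&` V).
    by apply: filterI => //; exact: open_nbhs_nbhs.
  exists (U', W') => _; split=> /=; [by exists a|by exists b| | |].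
  - by move=> z /U'U[].
  - by move=> z /W'W[].
  - apply/seteqP; split=> // z [/U'U[Uz _] /W'W[Wz _]].
    by rewrite -UW0; split.
pose U (s : seq bool) :=
  foldr (fun (b : bool) V => if b then (p V).1 else (p V).2) setT s.
have fatU s : fat (U s).
  elim: s => [|b s IH] /=; first by exists a0 => //; exact: filterT.
  by have [? ? _ _ _] := pP _ IH; case: b.
exists (fun s => closure (U s)); split=> [s|s|b s|s].
- exact: closed_closure.
- have [a _ aU] := fatU s.
  by exists a; apply: subset_closure; exact: nbhs_singleton.
- have [_ _ p1 p2 _] := pP _ (fatU s).
  by apply: subset_trans (@subset_closure _ _); case: b.
- by have [] := pP _ (fatU s).
Qed.

(** [F] is the complement of a maximal open set containing no [C i]; compactness of [C i] keeps this
    condition under unions of chains. *)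
Lemma minimal_closed_meeting (X : topologicalType) (I : Type)
    (C : I -> set X) : compact [set: X] ->
  (forall i, closed (C i)) -> (forall i, C i !=set0) ->
  exists F : set X, [/\ closed F, forall i, F `&` C i !=set0 &
    forall x U, F x -> nbhs x U -> exists i, F `&` C i `<=` U].
Proof.
move=> cX cC C0.
pose P : set (set X) := [set V | open V /\ forall i, ~ C i `<=` V].
have [G GP Gtot|V [[oV CV] Vmax]] := @Zorn_bigcup X P.
  split; first by apply: bigcup_open => V /GP[].
  move=> i CiG.
  have [V GV CiV] : exists2 V, G V & C i `<=` V.
    have cCi : compact (C i) by apply: (subclosed_compact _ cX).
    apply: (@compact_ideal _ _ [set B | exists2 V, G V & B `<=` V] cCi).
    (* The chain could be empty; a point of [C i] yields a member of it. *)
    - by have [x /CiG[V GV _]] := C0 i; exists V.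
    - by move=> A B AB [V GV BV]; exists V => //; exact: subset_trans BV.
    - move=> A B [V GV AV] [W GW BW]; have [VW|WV] := Gtot _ _ GV GW.
        by exists W => //; rewrite subUset; split=> //; exact: subset_trans VW.
      by exists V => //; rewrite subUset; split=> //; exact: subset_trans WV.
    - move=> x /CiG[V GV Vx]; exists V; last by exists V.
      by apply: open_nbhs_nbhs; split=> //; have [] := GP _ GV.
  by have [_ /(_ i)] := GP _ GV; apply.
exists (~` V); split=> [|i|x U Vx xU].
- exact: open_closedC.
- have /existsNP[x /not_implyP[Cx Vx]] := CV i.
  by exists x.
(* By maximality the larger open set must contain some [C i]. *)
- apply: contrapT => nC; apply: (Vmax (V `|` U°)).
    split; first by move=> z; left.
    by move=> /(_ x (or_intror xU)).
  split; first by apply: openU => //; exact: open_interior.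
  move=> i CVU; apply: nC; exists i => z [Vz /CVU[//|]].
  exact: interior_subset.
Qed.

(** Otherwise one shrinks neighbourhoods of points of [F], the closure at each stage avoiding the
    next [E m]; compactness gives a point of [F] outside every [E m]. *)
Lemma compact_baire (X : topologicalType) (F : set X) (E : nat -> set X) :
  compact [set: X] -> hausdorff_space X -> closed F -> F !=set0 ->
  (forall m, closed (E m)) -> F `<=` \bigcup_m E m ->
  exists m x U, [/\ F x, nbhs x U & F `&` U `<=` E m].
Proof.
move=> cX hX cF [x0 Fx0] cE FE; apply: contrapT => nE.
pose fat (U : set X) := exists2 x, F x & nbhs x U.
have /choice[p pP] (mU : nat * set X) : exists V : set X, fat mU.2 ->
    fat V /\ closure V `<=` mU.2 `&` ~` E mU.1.
  case: mU => m U /=.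
  have [[x Fx xU]|nU] := pselect (fat U); last by exists set0.
  have /existsNP[y /not_implyP[[Fy Uy] nEy]] : ~ F `&` U° `<=` E m.
    move=> FUE; apply: nE; exists m, x, U°.
    by split=> //; exact: nbhs_interior.
  have [|V yV VU] := @compact_regular X y setT hX cX filterT (U `&` ~` E m).
    apply: filterI => //; apply: open_nbhs_nbhs; split=> //.
    exact: closed_openC.
  by exists V => _; split=> //; exists y.
pose U := fix U m := if m is m'.+1 then p (m', U m') else setT.
have fatU m : fat (U m).
  elim: m => [|m IH]; first by exists x0 => //; exact: filterT.
  by have [] := pP (m, U m) IH.
have US m : closure (U m.+1) `<=` U m `&` ~` E m.
  by have [] := pP (m, U m) (fatU m).
have Udec m n : (m <= n)%N -> U n `<=` U m.
  move=> /subnK <-; elim: (n - m)%N => [//|k IH].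
  apply: subset_trans IH; rewrite addSn => z Uz.
  by have [] := US (k + m)%N z (subset_closure Uz).
have [x [Fx xU]] : exists x, F x /\ forall m, closure (U m) x.
  apply: contrapT => nx.
  have cptF : compact F by apply: (subclosed_compact cF cX).
  have [m Um] : exists m, F `&` U m = set0.
    apply: (@compact_ideal _ _ [set B | exists m, B `&` U m = set0] cptF).
    - by exists 0%N; rewrite set0I.
    - move=> A B AB [m Bm]; exists m; apply/seteqP; split=> // z [/AB Bz Uz].
      by rewrite -Bm.
    - move=> A B [m Am] [n Bn]; exists (maxn m n).
      apply/seteqP; split=> // z [[Az|Bz] Uz].
        by rewrite -Am; split=> //; exact: Udec (leq_maxl _ _) _ Uz.
      by rewrite -Bn; split=> //; exact: Udec (leq_maxr _ _) _ Uz.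
    - move=> x Fx; have /existsNP[m nUm] : ~ forall m, closure (U m) x.
        by move=> xU; apply: nx; exists x.
      exists (~` closure (U m)).
        apply: open_nbhs_nbhs; split=> //.
        exact/closed_openC/closed_closure.
      by exists m; apply/seteqP; split=> // z [] + /subset_closure.
  have [y Fy yU] := fatU m; suff : set0 y by [].
  by rewrite -Um; split=> //; exact: nbhs_singleton.
have [m _ Emx] := FE x Fx.
by have [_] := US m x (xU m.+1).
Qed.

(** A point lies in at most one of two siblings, so one descent in the scheme avoids each entry of
    [l]. *)
Lemma cantor_scheme_avoid (X : topologicalType) (F : set X)
    (C : seq bool -> set X) : (forall b s, C (b :: s) `<=` C s) ->
  (forall s, C (true :: s) `&` C (false :: s) = set0) ->
  (forall s, F `&` C s !=set0) ->
  forall (l : seq X) s, exists x, (F `&` C s) x /\ x \notin l.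
Proof.
move=> Csub Cdisj FC; elim=> [|y l IH] s.
  by have [x Fx] := FC s; exists x.
have [b nCy] : exists b, ~ C (b :: s) y.
  have [Cy|] := pselect (C (true :: s) y); last by exists true.
  by exists false => Cy'; have : set0 y by rewrite -(Cdisj s).
have [x [[Fx Cx] xl]] := IH (b :: s).
exists x; split; first by split=> //; exact: Csub Cx.
rewrite inE negb_or xl andbT; apply/eqP => xy; apply: nCy.
by rewrite -xy.
Qed.

(** The second clause is used with [E m] the points where a compact subset of [C_p(X)] is bounded
    above by [m]. *)
Lemma not_scattered_finite_sets (X : topologicalType) :
  compact [set: X] -> hausdorff_space X -> ~ scattered_space X ->
  exists S : nat -> seq X,
    (forall x, \forall n \near \oo, x \notin S n) /\
    forall E : nat -> set X, (forall m, closed (E m)) ->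
      (forall x, exists m, E m x) ->
      exists m, \forall n \near \oo, exists2 x, x \in S n & E m x.
Proof.
move=> cX hX /existsNP[A /not_implyP[A0 isoA]].
have {}isoA : isolated A = set0.
  by apply/seteqP; split=> // x xA; apply: isoA; exists x.
have [C [cC C0 Csub Cdisj]] := crowded_cantor_scheme cX hX A0 isoA.
have [F [cF FC Fmin]] := minimal_closed_meeting cX cC C0.
have avoid := cantor_scheme_avoid Csub Cdisj FC.
(* Enumerates the scheme; numbers coding no sequence give the root. *)
pose D k := C (odflt [::] (unpickle k)).
have /choice[pt ptP] (lk : seq X * nat) :
    exists x, (F `&` D lk.2) x /\ x \notin lk.1 by exact: avoid.
pose next n l := [seq pt (l, k) | k <- iota 0 n].
(* [hist n] collects the points of all earlier sets, which the [n]-th set must avoid. *)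
pose hist :=
  fix hist n := if n is n'.+1 then next n' (hist n') ++ hist n' else [::].
exists (fun n => next n (hist n)); split.
  move=> x.
  have [[n xn]|nx] := pselect (exists n, x \in next n (hist n)); last first.
    by apply: nearW => n; apply/negP => xn; apply: nx; exists n.
  exists n.+1 => // m /= nm; apply/negP => /mapP[k _ xk].
  have : x \in hist m.
    rewrite -(subnK nm); elim: (m - n.+1)%N => [|j IH] /=.
      by rewrite mem_cat xn.
    by rewrite mem_cat IH orbT.
  by apply/negP; rewrite xk; exact: (ptP (hist m, k)).2.
move=> E cE EX.
have F0 : F !=set0 by have [x [Fx _]] := FC [::]; exists x.
have [|m [x [U [Fx xU FUE]]]] := compact_baire cX hX cF F0 cE.
  by move=> x _; have [m Em] := EX x; exists m.
have [s FsU] := Fmin x U Fx xU.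
(* Once [n] exceeds the code of [s], the [n]-th set has a point in [F] and [C s], hence in [E m]. *)
exists m; exists (pickle s).+1 => // n /= sn.
have [[Fp Dp] _] := ptP (hist n, pickle s).
exists (pt (hist n, pickle s)).
  by apply: map_f; rewrite mem_iota.
apply: FUE; split=> //; apply: FsU; split=> //.
by move: Dp; rewrite /D pickleK.
Qed.

(** * From Ascoli to scattered *)

(** The sets of functions vanishing on a given finite set generate a filter converging to 0. *)
Lemma Cp_basis0 (R : realType) (X : topologicalType) (W : set (Cp R X)) :
  nbhs (cst 0 : Cp R X) W ->
  exists G : seq X, forall g : Cp R X, (forall x, x \in G -> g x = 0) -> W g.
Proof.
pose vanish (G : seq X) : set (Cp R X) :=
  [set g | forall x, x \in G -> g x = 0].
pose B := filter_from [set: seq X] vanish.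
have FB : Filter B.
  apply: filter_from_filter; first by exists [::].
  move=> G H _ _; exists (G ++ H) => // g gGH; split=> x xG; apply: gGH.
    by rewrite mem_cat xG.
  by rewrite mem_cat xG orbT.
have B0 : B --> (cst 0 : Cp R X).
  apply/Cp_cvgP => x V V0; exists [:: x] => // g gx /=.
  by rewrite gx ?inE //; exact: nbhs_singleton V0.
by move=> /B0[G _ GW]; exists G => g /GW.
Qed.

Lemma finite_urysohn (R : realType) (X : topologicalType) (G S : seq X)
    (c : R) :
  compact [set: X] -> hausdorff_space X -> (forall x, x \in G -> x \notin S) ->
  exists g : Cp R X, (forall x, x \in G -> g x = 0) /\
    forall x, x \in S -> g x = c.
Proof.
move=> cX hX GS.
have cl (l : seq X) : closed [set` l].
  by apply: compact_closed => //; apply: finite_compact; exact: finite_seq.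
have : @uniform_separator X [set` G] [set` S].
  apply: (normal_uniform_separator (compact_normal hX cX)) => //.
  by apply/seteqP; split=> // x [/= /GS /negP].
move=> /(@uniform_separatorP _ R)[h [ch _ hG hS]].
have cg : continuous (fun x => c * h x).
  by move=> x; apply: cvgM; [exact: cvg_cst|exact: ch].
exists (mkcts cg : Cp R X); split=> x xl; rewrite -[LHS]/(c * h x).
  by have -> : h x = 0; [apply: hG; exists x|rewrite mulr0].
by have -> : h x = 1; [apply: hS; exists x|rewrite mulr1].
Qed.

Lemma ascoli_Cp_scattered (R : realType) (X : topologicalType) :
  compact [set: X] -> hausdorff_space X -> ascoli_space R (Cp R X) ->
  scattered_space X.
Proof.
move=> cX hX [_ asc]; apply: contrapT => /(not_scattered_finite_sets cX hX).
move=> [S [Savoid Smeet]].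
pose bump n (g : Cp R X) : R := \prod_(x <- S n) Num.max 0 (g x - n%:R).
have cbump n : continuous (bump n).
  rewrite /bump; elim: (S n) => [|x l IH] g.
    under eq_fun do rewrite big_nil. exact: cvg_cst.
  under eq_fun do rewrite big_cons.
  pose p (h : Cp R X) : R := h x - n%:R.
  have cp : {for g, continuous p}.
    by apply: cvgB; [exact: Cp_eval_continuous|exact: cvg_cst].
  exact: continuousM (continuous_max (cvg_cst 0) cp) (IH g).
pose f n : Ck R (Cp R X) := mkcts (cbump n).
pose f0 : Ck R (Cp R X) := cst 0.
have f_f0 : f @ \oo --> f0.
  apply/Ck_cvgP => K O cK oO KO.
  pose E m := [set x : X | forall g : Cp R X, K g -> g x <= m%:R].
  have cE m : closed (E m).
    have -> : E m = \bigcap_(g in K) ((g : X -> R) @^-1` [set r | r <= m%:R]).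
      by apply/seteqP; split=> x Ex g /Ex.
    apply: closed_bigI => g _; apply: preimage_closed; last exact: closed_le.
    by move=> x _; exact: cts_fun.
  have [x|m Em] := Smeet E cE.
    have /compact_bounded[M [_ MK]] : compact [set g x | g in K].
      apply: continuous_compact cK; apply: continuous_subspaceT.
      exact: Cp_eval_continuous.
    have Mm := le_lt_trans (ler_norm M) (archi_boundP (normr_ge0 M)).
    exists (Num.bound `|M|) => g Kg; apply: le_trans (ler_norm _) _.
    by apply: (MK _ Mm); exists g.
  suff : \forall n \near \oo, [set f n g | g in K] `<=` O by [].
  near=> n => _ [g Kg <-]; apply: KO; exists g => //.
  (* The factor at this [x] is 0 because [g x <= m <= n], so [f n] vanishes on [K]. *)
  have [x xS Ex] : exists2 x, x \in S n & E m x by near: n.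
  rewrite /= /f /mkcts /bump /= (big_rem x xS) /=.
  rewrite max_l ?mul0r// subr_le0; apply: le_trans (Ex g Kg) _.
  by rewrite ler_nat; near: n; exact: nbhs_infty_ge.
have /asc evK := compact_cvg_seq f_f0.
pose K := f0 |` range f.
have Kf0 : K f0 by left.
have Kf n : K (f n) by right; exists n.
pose k0 : K := SigSub (mem_set Kf0); pose k n : K := SigSub (mem_set (Kf n)).
have k_k0 : k @ \oo --> k0 by apply/initial_cvgP.
have := evK (cst 0 : Cp R X, k0).
move=> /cvgrPdist_lt /(_ 1 ltr01) [[W V] [/= W0 Vk0] WV].
have [G GW] := Cp_basis0 W0.
have SG : \forall n \near \oo, forall x, x \in G -> x \notin S n.
  elim: G {GW} => [|y G IH]; first exact: nearW.
  near=> n => x; rewrite inE => /orP[/eqP ->|].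
    by near: n; exact: Savoid.
  by move: x; near: n.
have [n [SGn Vn]] : exists n, (forall x, x \in G -> x \notin S n) /\ V (k n).
  by have [n nP] := filter_ex (filterI SG (k_k0 _ Vk0)); exists n.
(* The value [n + 1] on [S n] makes every factor of [bump n g] equal to 1, while even continuity at
   [(0, f0)] requires absolute value below 1. *)
have [g [gG gS]] := finite_urysohn (n.+1%:R : R) cX hX SGn.
have := WV (g, k n) (conj (GW g gG) Vn).
have bump1 : bump n g = 1.
  rewrite /bump big_seq big1 // => x /gS ->.
  by rewrite -natr1 addrAC subrr add0r; apply: max_r.
by rewrite /= -[mkcts _ _]/(bump n g) bump1 sub0r normrN1 ltxx.
Unshelve. all: by end_near. Qed.

Theorem corollary1p5 (R : realType) (X : topologicalType)
    (compactX : compact [set: X]%classic) (hausdorffX : hausdorff_space X) :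
  [<-> ascoli_space R (Cp R X);
       frechet_urysohn_space (Cp R X);
       scattered_space X].
Proof.
tfae.
- move=> asc; apply: scattered_Cp_frechet_urysohn => //.
  exact: ascoli_Cp_scattered asc.
- move=> FU; apply: ascoli_Cp_scattered => //.
  by apply: frechet_urysohn_ascoli FU; exact: Cp_tychonoff.
- move=> sX; apply: frechet_urysohn_ascoli; first exact: Cp_tychonoff.
  exact: scattered_Cp_frechet_urysohn.
Qed.
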